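(* Let $d\in\mathbb N^*$. For any $L\in\mathbb N^*$, $p\in\mathbb N^*$ and $\mathbf s\in\{0,1\}^{\overline p}$, with $\overline p=p^2(L-1)+p(L+d+1)+1$, the class $\overline S_{(L,p,\mathbf s)}$ of functions realized by the ReLU neural network with fixed design $(L,p,\mathbf s)$ is VC-subgraph on $[0,1]^d$ with dimension $$V_{(L,p,\mathbf s)}\le(L+1)(\|\mathbf s\|_0+1)\log_2\left[2\left(2e(L+1)\left(\frac{pL}2+1\right)\right)^2\right],$$ where $\|\mathbf s\|_0$ denotes the number of non-zero components of $\mathbf s$.
   Context: $\sigma(x)=\max(0,x)$, applied componentwise to vectors. For $L,p\in\mathbb N^*$ consider functions on $[0,1]^d$ of the form $f=M_L\circ\sigma\circ M_{L-1}\circ\cdots\circ\sigma\circ M_0$, $M_l(y)=A_ly+b_l$, where $A_0$ is a $p\times d$ matrix, $A_l$ a $p\times p$ matrix for $1\le l\le L-1$, $A_L$ a $1\times p$ matrix, $b_l\in\mathbb R^p$ for $l<L$ and $b_L\in\mathbb R$; the total number of parameters is $\overline p$. The vector $\mathbf s=(\mathbf s_0^\top,\dots,\mathbf s_L^\top)^\top\in\{0,1\}^{\overline p}$ is a sparsity pattern: the entries of $\mathbf s_l$ correspond to the entries of $A_l$ (listed row after row) followed by those of $b_l$. $\overline S_{(L,p,\mathbf s)}$ is the set of all such $f$ in which parameters whose corresponding entry of $\mathbf s$ is $1$ vary freely in $\mathbb R$ and those whose entry is $0$ are fixed to $0$. A class $\mathcal F$ of real functions on a set $\mathscr W$ is VC-subgraph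 with dimension $V$ if $V$ is the largest cardinality of a finite set $\mathcal S\subset\mathscr W\times\mathbb R$ all of whose subsets are of the form $\mathcal S\cap\{(w,y):y<f(w)\}$ with $f\in\mathcal F$. *)

(* Defs.v *)
(* MathComp / MathComp-Analysis *)
From mathcomp Require Import all_boot all_order all_algebra.
From mathcomp Require Import all_classical all_reals all_analysis.
From mathcomp Require Import zify.
Set Implicit Arguments.
Unset Strict Implicit.
Unset Printing Implicit Defensive.
Import Order.TTheory GRing.Theory Num.Theory.
Local Open Scope classical_set_scope.
Local Open Scope ring_scope.

Section VC.
Variables (R : realType) (W : Type).

Definition subgraph (f : W -> R) : set (W * R) := [set wy | wy.2 < f wy.1].

Definition shatters (F : set (W -> R)) (S : set (W * R)) : Prop :=
  forall B, B `<=` S -> exists2 f, F f & B = S `&` subgraph f.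

(* "F is VC-subgraph with dimension V"; a finite set of cardinality n is a set
   in bijection with 'I_n, i.e. with `I_n = [set i | (i < n)%N]. *)
Definition VC_subgraph_dim (F : set (W -> R)) (V : nat) : Prop :=
  (exists2 S : set (W * R), (S #= `I_V)%card & shatters F S) /\
  (forall (n : nat) (S : set (W * R)), (S #= `I_n)%card -> shatters F S -> (n <= V)%N).

End VC.

Definition unit_cube (R : realType) (d : nat) : set 'cV[R]_d :=
  [set x : 'cV[R]_d | forall i, 0 <= x i 0 <= 1].
Arguments unit_cube : clear implicits.

Definition log2 (R : realType) (x : R) : R := ln x / ln 2.

Definition nb_params (d L p : nat) : nat :=
  (p ^ 2 * (L - 1) + p * (L + d + 1) + 1)%N.

(* All parameters are stored in one sequence, layer after layer; [offset d p l]
   is the position of the first entry of the block of (A_l, b_l). *)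
Definition offset (d p l : nat) : nat :=
  if l is l'.+1 then (p * d + p + l' * (p * p + p))%N else 0%N.

(* The last block, of size p + 1, ends exactly at nb_params d L p, so the
   default value of nth is never used below. *)
Lemma offset_last d L p : (0 < L)%N ->
  (offset d p L + (p + 1))%N = nb_params d L p.
Proof.
case: L => // L _; rewrite /offset /nb_params subn1 /= -mulnn; nia.
Qed.

Section Network.
Variable R : realType.

Definition relu (n : nat) (y : 'cV[R]_n) : 'cV[R]_n := map_mx (Num.max 0) y.

(* The block starting at position o lists the entries of the m x n matrix A row
   after row, followed by those of the vector b. *)
Definition block_weight (theta : seq R) (o m n : nat) : 'M[R]_(m, n) :=
  \matrix_(i < m, j < n) theta`_(o + i * n + j)%N.

Definition block_bias (theta : seq R) (o m n : nat) : 'cV[R]_m :=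
  \col_(i < m) theta`_(o + m * n + i)%N.

Definition affine (theta : seq R) (o m n : nat) (y : 'cV[R]_n) : 'cV[R]_m :=
  block_weight theta o m n *m y + block_bias theta o m n.

(* M_l \o sigma \o M_(l-1) \o ... \o sigma \o M_0, for l < L *)
Fixpoint hidden (d p : nat) (theta : seq R) (l : nat) (x : 'cV[R]_d)
    : 'cV[R]_p :=
  if l is l'.+1 then
    affine theta (offset d p l'.+1) p (relu (hidden p theta l' x))
  else affine theta (offset d p 0) p x.

(* The output for a network with L >= 1 hidden layers. *)
Definition network (d L p : nat) (theta : seq R) (x : 'cV[R]_d) : R :=
  affine theta (offset d p L) 1 (relu (hidden p theta L.-1 x)) 0 0.

Definition fixed_design_class (d L p : nat) (s : (nb_params d L p).-tuple bool)
    : set (unit_cube R d -> R) :=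
  [set f | exists2 theta : (nb_params d L p).-tuple R,
     forall k, tnth s k = false -> tnth theta k = 0
     & f = fun x => network L p theta (val x)].

End Network.

Definition norm0 (n : nat) (s : n.-tuple bool) : nat := count id s.

(* Main.v *)
Require Import Defs.
From mathcomp Require Import all_boot all_order all_algebra.
From mathcomp Require Import all_classical all_reals all_analysis.
From mathcomp Require Import zify ring lra.
Import Order.TTheory GRing.Theory Num.Theory.
Import numFieldNormedType.Exports.
Local Open Scope ring_scope.
Set Implicit Arguments.
Unset Strict Implicit.
Unset Printing Implicit Defensive.

(* Once the activation pattern of the first l layers on m sample points is
   fixed, the inputs of the units of layer l are polynomials of degree at most
   l + 1 in the free parameters. The number of dichotomies of the m points is
   thus at most the product over the layers of the numbers of sign patterns of
   such families of polynomials, while shattering requires 2^m dichotomies.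

   The number of sign patterns of M polynomials q_j of degree at most D in n
   variables is at most (2 e (2 D + 1) M / n)^n: a bound of Warren's type with a
   worse constant, which avoids Bezout's and Sard's theorems. Replace q_j by
   q_j - eps_j, with eps small and such that no point lies on more than n of the
   hypersurfaces q_j = eps_j; such an eps is found on a grid by counting. For
   each sign pattern tau, minimize \sum_i x_i^(2D+2) plus a large multiple of the
   sum of the squares of the violations of the inequalities prescribed by tau.
   At the minimizer the set K of violated or tight inequalities has at most n
   elements, and the minimizer solves x_i^(2D+1) = r_(K,i)(x) with r_(K,i) of
   degree at most 2D. This system has at most (2D+1)^n solutions, since on its
   zeros every polynomial is a combination of monomials with exponents at most
   2D. Finally tau is determined by its restriction to K and the minimizer. *)

(** * Polynomial functions and finite systems of polynomial equations *)

(** The matrix of [f] is diagonal and invertible, hence of rank [#|I|], but it factors through a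
    space of dimension [#|B|]. Later [I] indexes points, [f i] comes from a polynomial separating
    the point [i] from the others, and [e] lists monomials. *)
Lemma card_le_span (F : fieldType) (I B : finType) (f : I -> I -> F)
    (e : B -> I -> F) :
  (forall i, f i i != 0) -> (forall i j, i != j -> f i j = 0) ->
  (forall i, exists c : B -> F, forall j, f i j = \sum_b c b * e b j) ->
  (#|I| <= #|B|)%N.
Proof.
move=> f1 f0 /fin_all_exists[c fE].
pose C := \matrix_(i < #|I|, b < #|B|) c (enum_val i) (enum_val b).
pose E := \matrix_(b < #|B|, j < #|I|) e (enum_val b) (enum_val j).
have CE : C *m E = diag_mx (\row_i f (enum_val i) (enum_val i)).
  apply/matrixP => i j; rewrite !mxE.
  transitivity (f (enum_val i) (enum_val j)).
    rewrite fE (reindex (@enum_val B B)) /=; last exact/onW_bij/enum_val_bij.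
    by apply: eq_bigr => b _; rewrite !mxE.
  case: eqVneq => [->|ij]; first by rewrite mulr1n.
  by rewrite mulr0n f0 // (inj_eq enum_val_inj).
have U : C *m E \in unitmx.
  rewrite unitmxE CE det_diag unitfE; apply/prodf_neq0 => i _.
  by rewrite mxE.
rewrite -(mxrank_unit U) (leq_trans (mxrankM_maxl _ _)) //.
exact: rank_leq_col.
Qed.

Section Polyfun.
Variables (R : realType) (n : nat).
Local Notation E := 'rV[R]_n.

(** The degree bound has slack in both leaves, so that monotonicity in [D] follows by induction. *)
Inductive polyfun : nat -> (E -> R) -> Prop :=
| polyfun_cst D c : polyfun D (fun=> c)
| polyfun_coord D i : polyfun D.+1 (fun x => x ord0 i)
| polyfun_add D f g :
    polyfun D f -> polyfun D g -> polyfun D (fun x => f x + g x)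
| polyfun_mul D D' f g :
    polyfun D f -> polyfun D' g -> polyfun (D + D') (fun x => f x * g x).

Lemma polyfun_le D D' f : (D <= D')%N -> polyfun D f -> polyfun D' f.
Proof.
move=> le_D pf; elim: pf D' le_D => {D f}.
- by move=> D c D' _; exact: polyfun_cst.
- by move=> D i [//|D'] _; exact: polyfun_coord.
- by move=> D f g _ pf _ pg D' le; apply: polyfun_add; [exact: pf|exact: pg].
- move=> D1 D2 f g _ pf _ pg D' le.
  rewrite -(subnK le) addnA; apply: polyfun_mul; last exact: pg.
  by apply: pf; rewrite leq_addl.
Qed.

Lemma eq_polyfun D f g : f =1 g -> polyfun D f -> polyfun D g.
Proof. by move=> /funext ->. Qed.

Lemma polyfun_opp D f : polyfun D f -> polyfun D (fun x => - f x).
Proof.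
move=> pf; apply: (@eq_polyfun (0 + D) (fun x => -1 * f x)).
  by move=> x; rewrite mulN1r.
by apply: polyfun_mul => //; exact: polyfun_cst.
Qed.

Lemma polyfun_sub D f g :
  polyfun D f -> polyfun D g -> polyfun D (fun x => f x - g x).
Proof. by move=> pf pg; apply: polyfun_add => //; exact: polyfun_opp. Qed.

Lemma polyfun_scale D c f : polyfun D f -> polyfun D (fun x => c * f x).
Proof.
by move=> pf; rewrite -[D]add0n; apply: polyfun_mul => //; exact: polyfun_cst.
Qed.

Lemma polyfun_exp D f m : polyfun D f -> polyfun (m * D) (fun x => f x ^+ m).
Proof.
move=> pf; elim: m => [|m IH].
  exact: (polyfun_cst _ 1).
apply: (@eq_polyfun (m.+1 * D) (fun x => f x * f x ^+ m)).
  by move=> x; rewrite exprS.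
by rewrite mulSn; exact: polyfun_mul.
Qed.

Lemma polyfun_sum (I : Type) (s : seq I) (P : pred I) D (f : I -> E -> R) :
  (forall i, P i -> polyfun D (f i)) ->
  polyfun D (fun x => \sum_(i <- s | P i) f i x).
Proof.
move=> pf; elim: s => [|i s IH].
  by apply: (eq_polyfun _ (polyfun_cst D 0)) => x; rewrite big_nil.
case Pi : (P i); last by apply: eq_polyfun IH => x; rewrite big_cons Pi.
apply: (eq_polyfun _ (polyfun_add (pf _ Pi) IH)) => x.
by rewrite big_cons Pi.
Qed.

Lemma polyfun_prod (I : Type) (s : seq I) (P : pred I) (D : I -> nat)
    (f : I -> E -> R) :
  (forall i, P i -> polyfun (D i) (f i)) ->
  polyfun (\sum_(i <- s | P i) D i)%N (fun x => \prod_(i <- s | P i) f i x).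
Proof.
move=> pf; elim: s => [|i s IH].
  by rewrite big_nil; apply: (eq_polyfun _ (polyfun_cst 0 1)) => x; rewrite big_nil.
rewrite big_cons; case Pi : (P i).
  by apply: (eq_polyfun _ (polyfun_mul (pf _ Pi) IH)) => x; rewrite big_cons Pi.
by apply: eq_polyfun IH => x; rewrite big_cons Pi.
Qed.

(** Monomials are words in the variables, so that multiplying them is concatenation. *)
Definition mono (w : seq 'I_n) (x : E) : R := \prod_(i <- w) x ord0 i.

Lemma polyfun_mono w : polyfun (size w) (mono w).
Proof.
elim: w => [|i w IH].
  by apply: (eq_polyfun _ (polyfun_cst 0 1)) => x; rewrite /mono big_nil.
apply: (eq_polyfun _ (polyfun_mul (polyfun_coord 0 i) IH)) => x.
by rewrite /mono big_cons.
Qed.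

Lemma polyfun_words D f : polyfun D f ->
  exists2 l : seq (R * seq 'I_n), all (fun cw => size cw.2 <= D)%N l &
    forall x, f x = \sum_(cw <- l) cw.1 * mono cw.2 x.
Proof.
elim=> {D f} [D c|D i|D f g _ [l lD lE] _ [l' lD' lE']
             |D D' f g _ [l lD lE] _ [l' lD' lE']].
- exists [:: (c, [::])] => // x.
  by rewrite big_seq1 /= /mono big_nil mulr1.
- exists [:: (1, [:: i])] => // x.
  by rewrite big_seq1 /= /mono big_seq1 mul1r.
- exists (l ++ l'); first by rewrite all_cat lD.
  by move=> x; rewrite big_cat lE lE'.
- exists [seq (u.1 * v.1, u.2 ++ v.2) | u <- l, v <- l'].
    apply/allP => _ /allpairsP[[u v] /= [ul vl ->]] /=.
    by rewrite size_cat leq_add // ?(allP lD) ?(allP lD').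
  move=> x; rewrite lE lE' big_allpairs_dep /= mulr_suml.
  apply: eq_bigr => u _; rewrite mulr_sumr; apply: eq_bigr => v _.
  by rewrite /mono big_cat /= mulrACA.
Qed.

(** Each exponent separately is less than [N]; there are [N ^ n] such monomials, whatever the total
    degree. *)
Definition rmono N (a : {ffun 'I_n -> 'I_N}) (x : E) : R :=
  \prod_i x ord0 i ^+ a i.

Definition in_rspan N (Z : E -> Prop) (f : E -> R) : Prop :=
  exists c : {ffun 'I_n -> 'I_N} -> R,
    forall x, Z x -> f x = \sum_a c a * rmono a x.

Lemma in_rspan_sum N Z (I : Type) (s : seq I) (P : pred I) (c : I -> R)
    (f : I -> E -> R) :
  (forall i, P i -> in_rspan N Z (f i)) ->
  in_rspan N Z (fun x => \sum_(i <- s | P i) c i * f i x).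
Proof.
move=> fP; elim: s => [|i s [cs csE]].
  exists (fun=> 0) => x _; rewrite big_nil big1 // => a _.
  by rewrite mul0r.
case Pi : (P i); last by exists cs => x Zx; rewrite big_cons Pi csE.
have [ci ciE] := fP _ Pi.
exists (fun a => c i * ci a + cs a) => x Zx; rewrite big_cons Pi csE // ciE //.
rewrite mulr_sumr -big_split /=; apply: eq_bigr => a _.
by rewrite mulrDl mulrA.
Qed.

Lemma mono_count w x : mono w x = \prod_i x ord0 i ^+ count_mem i w.
Proof.
rewrite /mono; elim: w => [|j w IH].
  by rewrite big_nil big1.
rewrite big_cons IH (bigD1 j) //= [in RHS](bigD1 j) //= eqxx add1n exprS.
rewrite -!mulrA; congr (_ * (_ * _)); apply: eq_bigr => i ij.
by rewrite eq_sym (negbTE ij).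
Qed.

Lemma mono_rspan N Z w : (forall i, count_mem i w < N)%N -> in_rspan N Z (mono w).
Proof.
move=> wN; exists (fun a => (a == [ffun i => Ordinal (wN i)])%:R) => x _.
rewrite (bigD1 [ffun i => Ordinal (wN i)]) //= eqxx mul1r big1 ?addr0.
  by rewrite mono_count; apply: eq_bigr => i _; rewrite ffunE.
by move=> a /negbTE ->; rewrite mul0r.
Qed.

Lemma polyfun_rspan D f : polyfun D f -> in_rspan D.+1 (fun=> True) f.
Proof.
move=> /polyfun_words[l lD lE].
have -> : f = (fun x => \sum_(i < size l) (tnth (in_tuple l) i).1 *
                  mono (tnth (in_tuple l) i).2 x).
  by apply/funext => x; rewrite lE big_tnth.
apply: in_rspan_sum => i _; apply: mono_rspan => j; rewrite ltnS.
apply: leq_trans (count_size _ _) _.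
by apply: (allP lD); exact: mem_tnth.
Qed.

(* Substituting [r i] for ['X_i ^ N.+1] in a monomial lowers its degree. *)
Lemma polyfun_rspan_reduce N (Z : E -> Prop) (r : 'I_n -> E -> R) :
  (forall i, polyfun N (r i)) ->
  (forall x, Z x -> forall i, x ord0 i ^+ N.+1 = r i x) ->
  forall D f, polyfun D f -> in_rspan N.+1 Z f.
Proof.
move=> rN Zr; elim/ltn_ind => D IH f /polyfun_words[l lD lE].
have -> : f = (fun x => \sum_(i < size l) (tnth (in_tuple l) i).1 *
                  mono (tnth (in_tuple l) i).2 x).
  by apply/funext => x; rewrite lE big_tnth.
apply: in_rspan_sum => k _.
have: (size (tnth (in_tuple l) k).2 <= D)%N.
  by apply: (allP lD); exact: mem_tnth.
move: (_.2) => w wD.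
have [/forallP wN|] := boolP [forall i, (count_mem i w < N.+1)%N].
  exact: mono_rspan.
rewrite negb_forall => /existsP[i]; rewrite -leqNgt => wi.
(* [w'] is [w] with [N.+1] occurrences of [i] taken out. *)
pose w' := nseq (count_mem i w - N.+1) i ++ [seq j <- w | predC1 i j].
have ww' : perm_eq w (nseq N.+1 i ++ w').
  rewrite catA -nseqD subnKC // -size_filter.
  have /all_pred1P <- := filter_all (pred1 i) w.
  by rewrite perm_sym; apply/permPl/perm_filterC.
have sw : (size w = N.+1 + size w')%N.
  by rewrite (perm_size ww') size_cat size_nseq.
have [c cE] : in_rspan N.+1 Z (fun x => r i x * mono w' x).
  (* A factor of degree [N.+1] has been replaced by one of degree [N]. *)
  apply: (IH (N + size w')%N); first by rewrite -ltnS ltnS -addSn -sw.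
  by apply: polyfun_mul => //; exact: polyfun_mono.
exists c => x Zx; rewrite -cE // -Zr // /mono (perm_big _ ww') big_cat.
by rewrite big_nseq iter_mulr_1.
Qed.

(** Products of differences of coordinates separate the points. On these points they reduce to
    combinations of the [N.+1 ^ n] monomials with exponents at most [N], so [card_le_span]
    applies. *)
Lemma card_zeros (I : finType) N (r : 'I_n -> E -> R) (z : I -> E) :
  injective z -> (forall i, polyfun N (r i)) ->
  (forall k i, z k ord0 i ^+ N.+1 = r i (z k)) -> (#|I| <= N.+1 ^ n)%N.
Proof.
move=> z_inj rN zr.
(* A coordinate in which [z k] and [z j] differ; as [z] is injective, [None] occurs only for
   [k = j]. *)
pose s k j := [pick i | z k ord0 i != z j ord0 i].
have sP k j : k != j ->
    if s k j is Some i then z k ord0 i != z j ord0 i else false.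
  rewrite /s; case: pickP => // zkj /eqP[]; apply: z_inj; apply/rowP => i.
  by have := zkj i; rewrite /= => /negbFE/eqP.
pose g k j (x : E) : R := if s k j is Some i then x ord0 i - z j ord0 i else 1.
pose f k (x : E) := \prod_(j | j != k) g k j x.
have pf k : polyfun (\sum_(j | j != k) 1)%N (f k).
  apply: polyfun_prod => j jk; rewrite /g.
  case: (s k j) => [i|]; last exact: polyfun_cst.
  by apply: polyfun_sub; [exact: polyfun_coord|exact: polyfun_cst].
rewrite -[X in (_ <= X ^ _)%N]card_ord -[X in (_ <= _ ^ X)%N]card_ord -card_ffun.
apply: (@card_le_span R I _ (fun k j => f k (z j)) (fun a j => rmono a (z j))).
- move=> k; apply/prodf_neq0 => j jk; rewrite /g.
  by have := sP k j; rewrite eq_sym jk; case: (s k j) => // i;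
    rewrite subr_eq0; apply.
- move=> k j kj; rewrite /f (bigD1 j) 1?eq_sym //= /g.
  by have := sP k j kj; case: (s k j) => // i _; rewrite subrr mul0r.
- move=> k.
  have Zr (x : E) : (exists j, x = z j) -> forall i, x ord0 i ^+ N.+1 = r i x.
    by move=> [j ->] i; exact: zr.
  have [c cE] := polyfun_rspan_reduce rN Zr (pf k).
  by exists c => j; apply: cE; exists j.
Qed.

End Polyfun.

(** * Generic levels *)

Lemma card_le_fibers (T U : finType) (A : {set T}) (P : {set U}) (f : T -> U) b :
  (forall x, x \in A -> f x \in P) ->
  (forall u, u \in P -> (#|[set x in A | f x == u]| <= b)%N) ->
  (#|A| <= #|P| * b)%N.
Proof.
move=> fP Pb; rewrite -sum1_card (partition_big f (mem P)) //=.
rewrite -sum_nat_const leq_sum // => u uP.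
apply: leq_trans (Pb _ uP); rewrite -sum1_card.
by rewrite [leqRHS](eq_bigl (fun x => (x \in A) && (f x == u))) // => x; rewrite inE.
Qed.

Lemma exists_subset_card (T : finType) (A : {set T}) m :
  (m <= #|A|)%N -> exists2 K : {set T}, K \subset A & #|K| = m.
Proof.
move=> /card_geqP[s [us <- sA]]; exists [set x in s].
  by apply/fintype.subsetP => x; rewrite inE => /sA.
by rewrite cardsE; apply/card_uniqP.
Qed.

Section GenericLevels.
Variables (R : realType) (n : nat).
Local Notation E := 'rV[R]_n.
Variables (J : finType) (D : nat) (q : J -> E -> R).
Hypothesis qD : forall j, polyfun D (q j).

Section Grid.
Variables (N : nat) (v : 'I_N.+1 -> R).
Hypothesis v_inj : injective v.

Definition bad_levels (K : {set J}) : {set {ffun J -> 'I_N.+1}} :=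
  [set u : {ffun J -> 'I_N.+1} | `[< exists x, forall j, j \in K -> q j x = v (u j) >]].

(* The products of the [q j - v i] over [j] in [K] and [i <> u j] separate the
   points realizing the levels [u]. *)
Lemma card_bad_slice (K : {set J}) (S : {set {ffun J -> 'I_N.+1}}) :
  S \subset bad_levels K ->
  {in S &, forall u u' : {ffun J -> 'I_N.+1},
     {in K, u =1 u'} -> u = u'} ->
  (#|S| <= (#|K| * N.+1 * D).+1 ^ n)%N.
Proof.
move=> /fintype.subsetP Sbad S_inj.
pose I := {u : {ffun J -> 'I_N.+1} | u \in S}.
have [z zE] : exists z : I -> E, forall u : I, forall j, j \in K ->
    q j (z u) = v (val u j).
  apply: (@fin_all_exists I (fun=> E)
    (fun (u : I) x => forall j, j \in K -> q j x = v (val u j))).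
  by move=> [u uS]; have := Sbad _ uS; rewrite inE => /asboolP.
pose f (u : I) x := \prod_(j in K) \prod_(i | i != val u j) (q j x - v i).
have pf u : polyfun (#|K| * N.+1 * D) (f u).
  rewrite -mulnA -sum_nat_const; apply: polyfun_prod => j _.
  apply: (@polyfun_le _ _ (\sum_(i | i != val u j) D)).
    rewrite -[X in (_ <= X * _)%N]card_ord -sum_nat_const.
    by rewrite [leqRHS](bigID (fun i => i != val u j)) /= leq_addr.
  apply: polyfun_prod => i _; apply: polyfun_sub => //; exact: polyfun_cst.
have cardI : #|{: I}| = #|S| by rewrite card_sig; apply: eq_card.
rewrite -cardI -[X in (_ <= X ^ _)%N]card_ord -[X in (_ <= _ ^ X)%N]card_ord.
rewrite -card_ffun.
apply: (@card_le_span R I _ (fun k j => f k (z j)) (fun a j => rmono a (z j))).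
- move=> u; apply/prodf_neq0 => j jK; apply/prodf_neq0 => i iu.
  by rewrite zE // subr_eq0 (inj_eq v_inj) eq_sym.
- move=> u u' uu'.
  have [j jK uj] : exists2 j, j \in K & val u j != val u' j.
    apply/exists_inP; rewrite -[[exists _ in _, _]]negbK negb_exists_in.
    apply: contra uu' => /forall_inP uu'; apply/eqP/val_inj.
    apply: S_inj (valP u) (valP u') _ => j /uu'.
    by rewrite negbK => /eqP.
  rewrite /f (bigD1 j) //= (bigD1 (val u' j)) 1?eq_sym //= zE // subrr.
  by rewrite !mul0r.
- move=> u; have [c cE] := polyfun_rspan (pf u).
  by exists c => j; rewrite cE.
Qed.

(** Fixing the levels outside [K] cuts the bad levels into slices, each bounded by [card_bad_slice].
    For [#|K| = n.+1] the powers of [N.+1] add up to [#|J| - 1], so on a fine grid some levels are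
    bad for no such [K]. *)
Lemma card_bad_levels (K : {set J}) :
  (#|bad_levels K| <=
    N.+1 ^ (#|J| - #|K|) * (#|K| * N.+1 * D).+1 ^ n)%N.
Proof.
pose f (u : {ffun J -> 'I_N.+1}) := [ffun j => if j \in K then ord0 else u j].
pose P := [set w | w \in pffun_on (@ord0 N) (~: K) predT].
have -> : (N.+1 ^ (#|J| - #|K|))%N = #|P|.
  by rewrite cardsE card_pffun_on card_ord [in RHS]cardsCs finset.setCK.
apply: (@card_le_fibers _ _ _ _ f) => [u _|w _].
  rewrite inE; apply/pffun_onP; split => //.
  apply/fintype.subsetP => j; rewrite !inE ffunE.
  by case: ifP => //; rewrite eqxx.
apply: card_bad_slice.
  by apply/fintype.subsetP => u; rewrite inE => /andP[].
move=> u u'; rewrite inE => /andP[_ /eqP uw]; rewrite inE => /andP[_ /eqP u'w].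
move=> uu'; apply/ffunP => j; case jK : (j \in K); first exact: uu'.
by have := congr1 (fun w : {ffun _ -> _} => w j) (etrans uw (esym u'w));
  rewrite !ffunE jK.
Qed.

End Grid.

Lemma generic_levels (e : R) : 0 < e ->
  exists2 eps : J -> R, forall j, 0 < eps j < e &
    forall x, (#|[set j | q j x == eps j]| <= n)%N.
Proof.
(* [C] bounds the factor of [card_bad_levels] that does not grow with the grid, and [N] makes [N.+1]
   exceed the number of sets [K] times [C]. *)
move=> e0; pose C := ((n.+1 * D.+1) ^ n)%N; pose N := (2 ^ #|J| * C)%N.
pose v (i : 'I_N.+1) : R := e * (i.+1%:R / N.+2%:R).
have N2 : (0 : R) < N.+2%:R by rewrite ltr0n.
have v_inj : injective v.
  move=> i k /(mulfI (lt0r_neq0 e0))/(divIf (lt0r_neq0 N2))/eqP.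
  by rewrite eqr_nat eqSS => /eqP/val_inj.
(* Sets of exactly [n.+1] indices suffice, since any larger set contains one. *)
have [u uP] : exists u : {ffun J -> 'I_N.+1}, forall K : {set J},
    #|K| = n.+1 -> u \notin bad_levels v K.
  apply: contrapT => noP.
  have allP (u : {ffun J -> 'I_N.+1}) :
      exists K : {set J}, (#|K| == n.+1) && (u \in bad_levels v K).
    apply: contrapT => noK; apply: noP; exists u => K /eqP Kn.
    by apply/negP => uK; apply: noK; exists K; rewrite Kn.
  pose f (u : {ffun J -> 'I_N.+1}) := xchoose (allP u).
  have fP u : (#|f u| == n.+1) /\ (u \in bad_levels v (f u)).
    by apply/andP; exact: (xchooseP (allP u)).
  (* This keeps [#|J|.-1] and [#|J| - n.+1] below from being truncated. *)
  have nJ : (n.+1 <= #|J|)%N.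
    by have [/eqP <- _] := fP [ffun=> ord0]; exact: max_card.
  pose P : {set {set J}} := [set K : {set J} | #|K| == n.+1].
  have : (#|[set: {ffun J -> 'I_N.+1}]| <= #|P| * (N.+1 ^ #|J|.-1 * C))%N.
    apply: (@card_le_fibers _ _ _ _ f) => [u _|K].
      by rewrite inE; have [] := fP u.
    rewrite inE => /eqP Kn; apply: (@leq_trans #|bad_levels v K|).
      apply/subset_leq_card/fintype.subsetP => u.
      by rewrite inE => /andP[_ /eqP <-]; have [] := fP u.
    apply: leq_trans (card_bad_levels v_inj K) _; rewrite Kn.
    have -> : (#|J|.-1 = (#|J| - n.+1) + n)%N by lia.
    rewrite expnD -[leqRHS]mulnA leq_mul2l /C -expnMn; apply/orP; right.
    case: (posnP n) => [->//|n0]; rewrite leq_exp2r //; nia.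
  rewrite cardsT card_ffun card_ord; apply/negP; rewrite -ltnNge.
  have -> : (N.+1 ^ #|J| = N.+1 ^ #|J|.-1 * N.+1)%N.
    by rewrite -expnSr prednK //; exact: leq_trans nJ.
  rewrite mulnCA ltn_mul2l expn_gt0 /= ltnS /N leq_mul2r.
  apply/orP; right; apply: leq_trans (max_card _) _.
  by rewrite -cardsT -powersetT card_powerset cardsT.
exists (fun j => v (u j)) => [j|x].
  rewrite /v mulr_gt0 ?divr_gt0 ?ltr0n //= gtr_pMr // ltr_pdivrMr // mul1r.
  by rewrite ltr_nat ltnS ltn_ord.
rewrite leqNgt; apply/negP => /exists_subset_card[K /fintype.subsetP KJ Kn].
have /negP[] := uP K Kn; rewrite inE; apply/asboolP; exists x => j /KJ.
by rewrite inE => /eqP.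
Qed.

End GenericLevels.

(** * Minimizers of the penalized energy *)

Lemma horner_min_deriv (R : realType) (p : {poly R}) :
  (forall s, p.[0] <= p.[s]) -> p^`().[0] = 0.
Proof.
move=> pmin; have p0 : is_derive (0 : R) 1 (horner p) 0.
  apply: (@derive1_at_min _ _ (-1) 1) => [|s _|| s _]; first by lra.
  - exact: derivable_horner.
  - by rewrite in_itv /=; apply/andP; lra.
  - exact: pmin.
have pE : is_derive (0 : R) 1 (horner p) p^`().[0] by exact: is_derive_poly.
by rewrite -(@derive_val _ _ _ _ _ _ _ pE) (@derive_val _ _ _ _ _ _ _ p0).
Qed.

Section PolyfunAnalysis.
Variables (R : realType) (n : nat).
Local Notation E := 'rV[R]_n.

Lemma polyfun_continuous D (f : E -> R) : polyfun D f -> continuous f.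
Proof.
elim=> {D f} [D c|D i|D f g _ cf _ cg|D D' f g _ cf _ cg] x.
- exact: cst_continuous.
- exact: coord_continuous.
- exact: (continuousD (cf x) (cg x)).
- exact: (continuousM (cf x) (cg x)).
Qed.

(** The [i]-th partial derivative, read off the polynomial that [f] induces on each line in
    direction [i]; only formal derivatives in one variable occur. *)
Definition line_deriv i (f f' : E -> R) : Prop :=
  forall x, exists2 p : {poly R},
    forall s, p.[s] = f (x + s *: delta_mx ord0 i) & p^`().[0] = f' x.

Lemma polyfun_line_deriv D (f : E -> R) i : polyfun D f ->
  exists2 f' : E -> R, polyfun D f' & line_deriv i f f'.
Proof.
elim=> {D f} [D c|D j|D f g _ [f' Df' f'P] _ [g' Dg' g'P]
             |D D' f g pf [f' Df' f'P] pg [g' Dg' g'P]].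
- exists (fun=> 0); first exact: polyfun_cst.
  by move=> x; exists c%:P => [s|]; rewrite ?derivC hornerE.
- exists (fun=> (j == i)%:R); first exact: polyfun_cst.
  move=> x; exists ((x ord0 j)%:P + (j == i)%:R *: 'X) => [s|].
    by rewrite !hornerE !mxE eqxx /= mulrC.
  by rewrite derivD derivC derivZ derivX !hornerE.
- exists (fun x => f' x + g' x); first exact: polyfun_add.
  move=> x; have [p pE p'] := f'P x; have [r rE r'] := g'P x.
  by exists (p + r) => [s|]; rewrite ?derivD hornerD ?pE ?rE ?p' ?r'.
- exists (fun x => f' x * g x + f x * g' x).
    by apply: polyfun_add; exact: polyfun_mul.
  move=> x; have [p pE p'] := f'P x; have [r rE r'] := g'P x.
  exists (p * r) => [s|]; first by rewrite hornerM pE rE.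
  by rewrite derivM hornerD !hornerM p' r' pE rE scale0r addr0.
Qed.

Lemma box_compact (b : R) : compact [set x : E | forall i, -b <= x ord0 i <= b]%classic.
Proof.
have -> : [set x : E | forall i, -b <= x ord0 i <= b]%classic =
    [set x : E | forall i, `[-b, b]%classic (x ord0 i)]%classic.
  by apply/funext => x; apply/propext; split => xb i; have := xb i;
    rewrite /= in_itv.
exact: (@rV_compact R n (fun=> `[-b, b]%classic) (fun=> @segment_compact R _ _)).
Qed.

Lemma box_min (f : E -> R) (b : R) : 0 <= b -> continuous f ->
  exists2 c : E, (forall i, -b <= c ord0 i <= b) &
    forall x : E, (forall i, -b <= x ord0 i <= b) -> f c <= f x.
Proof.
move=> b0 cf.
have [||c cb cmin] := compact_EVT_min (f := f) _ (@box_compact b).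
- by exists 0 => /= i; rewrite mxE oppr_le0 b0.
- exact: continuous_subspaceT.
exists c => [|x xb]; first by have := cb; rewrite inE.
by apply: cmin; rewrite inE.
Qed.

End PolyfunAnalysis.

Section Penalized.
Variables (R : realType) (n D : nat) (J : finType).
Local Notation E := 'rV[R]_n.
Variables (v : J -> E -> R) (t : R).
Hypotheses (vD : forall j, polyfun D (v j)) (t0 : 0 <= t).

(** The exponent is even, so the energy bounds all coordinates. Its partial derivatives have degree
    [2D + 1], one more than those of a squared polynomial of degree [D] are allowed by the bound
    [2D]. *)
Definition energy (x : E) : R := \sum_i x ord0 i ^+ D.+1.*2.

Definition penalized (x : E) : R :=
  energy x + t * \sum_j Num.max 0 (v j x) ^+ 2.

Lemma energy_ge (x : E) i : x ord0 i ^+ D.+1.*2 <= energy x.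
Proof.
rewrite /energy (bigD1 i) //= lerDl sumr_ge0 // => k _.
by rewrite exprn_even_ge0 // odd_double.
Qed.

Lemma energy_ge0 x : 0 <= energy x.
Proof.
by rewrite sumr_ge0 // => k _; rewrite exprn_even_ge0 // odd_double.
Qed.

Lemma energy_le_penalized x : energy x <= penalized x.
Proof. by rewrite lerDl mulr_ge0 // sumr_ge0 // => j _; exact: sqr_ge0. Qed.

Lemma penalized_continuous : continuous penalized.
Proof.
move=> x; apply: continuousD.
  apply: (@polyfun_continuous _ _ D.+1.*2); apply: polyfun_sum => i _.
  by have := polyfun_exp D.+1.*2 (polyfun_coord R 0 i); rewrite muln1.
apply: continuousM; first exact: cst_continuous.
elim: (index_enum J) => [|j s IH].
  have -> : (fun y => \sum_(k <- [::]) Num.max 0 (v k y) ^+ 2) = (fun=> 0).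
    by apply/funext => y; rewrite big_nil.
  exact: cst_continuous.
have cm : {for x, continuous (fun y => Num.max 0 (v j y))}.
  apply: continuous_max; first exact: cst_continuous.
  exact: (polyfun_continuous (vD j)).
have -> : (fun y => \sum_(k <- j :: s) Num.max 0 (v k y) ^+ 2) =
    (fun y => Num.max 0 (v j y) * Num.max 0 (v j y) +
      \sum_(k <- s) Num.max 0 (v k y) ^+ 2).
  by apply/funext => y; rewrite big_cons expr2.
exact: (continuousD (continuousM cm cm) IH).
Qed.

Lemma box_of_energy (x : E) (b : R) : 1 <= b -> energy x <= b ->
  forall i, - b <= x ord0 i <= b.
Proof.
move=> b1 xb i; rewrite -ler_norml leNgt; apply/negP => bx.
have x1 : 1 <= `|x ord0 i| by exact: le_trans (ltW bx).
have := le_trans (energy_ge x i) xb; apply/negP; rewrite -ltNge.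
apply: lt_le_trans bx _.
rewrite -[leRHS]ger0_norm ?exprn_even_ge0 ?odd_double // normrX.
by rewrite -[leLHS]expr1 ler_weXn2l.
Qed.

Lemma penalized_min : exists x, forall y, penalized x <= penalized y.
Proof.
(* Where the energy exceeds [b], [penalized] exceeds its value at 0. The summand 1 serves
   [box_of_energy]. *)
pose b := 1 + penalized 0.
have F0 : 0 <= penalized 0 by apply: le_trans (energy_le_penalized 0); exact: energy_ge0.
have b0 : 0 <= b by rewrite addr_ge0.
have [c _ cmin] := box_min b0 penalized_continuous.
exists c => y; have [yb|yb] := leP (energy y) b.
  by apply: cmin; apply: box_of_energy yb; rewrite lerDl.
apply: le_trans (cmin 0 _) _; first by move=> i; rewrite mxE oppr_le0 b0.
apply: le_trans (energy_le_penalized y); apply: le_trans (ltW yb).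
by rewrite lerDr.
Qed.

(** This is the vanishing of the [i]-th partial derivative at a minimizer, divided by 2. The penalty
    is only piecewise polynomial, so a polynomial majorant touching it at [x] is differentiated
    instead. *)
Lemma penalized_critical (i : 'I_n) (v' : J -> E -> R) x :
  (forall j, line_deriv i (v j) (v' j)) ->
  (forall y, penalized x <= penalized y) ->
  D.+1%:R * x ord0 i ^+ D.*2.+1 =
    - (t * \sum_j Num.max 0 (v j x) * v' j x).
Proof.
move=> v'P xmin.
have [p pP] : exists p : J -> {poly R}, forall j,
    (forall s, (p j).[s] = v j (x + s *: delta_mx ord0 i)) /\
    (p j)^`().[0] = v' j x.
  by apply: (@fin_all_exists J (fun=> {poly R}) (fun j p => (forall s,
    p.[s] = v j (x + s *: delta_mx ord0 i)) /\ p^`().[0] = v' j x)) => j;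
    have [p ? ?] := v'P j x; exists p.
have pE j s : (p j).[s] = v j (x + s *: delta_mx ord0 i) by have [] := pP j.
have p0 j : (p j).[0] = v j x by rewrite pE scale0r addr0.
(* On the line through [x] in direction [i], the polynomial [Q] is above
   [penalized] and equal to it at [x]. *)
pose Q := (\sum_(k | k != i) x ord0 k ^+ D.+1.*2)%:P
  + ((x ord0 i)%:P + 'X) ^+ D.+1.*2
  + t *: \sum_j (p j + (Num.max 0 (v j x) - v j x)%:P) ^+ 2.
have QE s : Q.[s] = \sum_(k | k != i) x ord0 k ^+ D.+1.*2 +
    (x ord0 i + s) ^+ D.+1.*2 +
    t * \sum_j (v j (x + s *: delta_mx ord0 i) + (Num.max 0 (v j x) - v j x)) ^+ 2.
  rewrite /Q !hornerE horner_sum; congr (_ + _ * _).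
  by apply: eq_bigr => j _; rewrite !hornerE pE.
have enE (y : E) :
    energy y = \sum_(k | k != i) y ord0 k ^+ D.+1.*2 + y ord0 i ^+ D.+1.*2.
  by rewrite /energy (bigD1 i) //= addrC.
have Q0 : Q.[0] = penalized x.
  rewrite QE /penalized enE addr0; congr (_ + _ * _); apply: eq_bigr => j _.
  by rewrite scale0r addr0 addrCA subrr addr0.
have Qs s : penalized (x + s *: delta_mx ord0 i) <= Q.[s].
  rewrite QE /penalized enE; apply: lerD.
    rewrite !mxE !eqxx mulr1 lerD // ler_sum // => k ki.
    by rewrite !mxE (negbTE ki) andbF mulr0 addr0.
  rewrite ler_wpM2l //; apply: ler_sum => j _.
  (* The majorant squares [c] if [0 <= a], and [c - a > c] if [a < 0]; both squares are at least
     that of [max(0, c)]. *)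
  set a := v j x; set c := v j _.
  have [a0|a0] := leP 0 a; have [c0|c0] := leP 0 c;
    rewrite ?expr0n /= ?sqr_ge0 //; nra.
have := horner_min_deriv (p := Q) (fun s =>
  le_trans (eq_ind_r (fun z => z <= _) (xmin _) Q0) (Qs s)).
rewrite /Q !derivD !derivC derivZ raddf_sum add0r deriv_exp derivD derivC derivX.
rewrite add0r mul1r hornerD hornerMn horner_exp !hornerE horner_sum /=.
rewrite (eq_bigr (fun j => 2 * (Num.max 0 (v j x) * v' j x))) => [|j _]; last first.
  rewrite expr2 derivM derivD derivC addr0 !hornerE p0 /=.
  by have [_ ->] := pP j; ring.
rewrite -mulr_sumr; set X := _ ^+ _; set S := \sum_j _.
by rewrite -mulr_natl -muln2 natrM; lra.
Qed.

End Penalized.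

(** * Counting sign patterns *)

Lemma finite_pos_lower_bound (R : realType) (I : finType) (P : pred I) (F : I -> R) :
  (forall i, P i -> 0 < F i) -> exists2 e, 0 < e & forall i, P i -> e <= F i.
Proof.
move=> F0; exists (\big[Num.min/1]_(i | P i) F i).
  exact: lt_bigmin.
by move=> i Pi; exact: bigmin_le_cond.
Qed.

Section SignPatterns.
Variables (R : realType) (n : nat) (J : finType) (D : nat).
Local Notation E := 'rV[R]_n.
Variable q : J -> E -> R.
Hypothesis qD : forall j, polyfun D (q j).

Section Critical.
Variables (eps : J -> R) (B : R).
Hypothesis eps_generic : forall x, (#|[set j | q j x == eps j]| <= n)%N.

(** At most [n] of the [q j - eps j] vanish at a point, so a sum of [n.+1] of their squares is
    positive, and by compactness bounded away from 0 where the energy is at most [B]. *)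
Lemma levels_separated :
  exists2 c : R, 0 < c & forall (K : {set J}) (x : E), #|K| = n.+1 ->
    energy D x <= B -> c <= \sum_(j in K) (q j x - eps j) ^+ 2.
Proof.
have cK (K : {set J}) : exists c : R, #|K| = n.+1 -> 0 < c /\
    forall x, energy D x <= B -> c <= \sum_(j in K) (q j x - eps j) ^+ 2.
  have [Kn|] := eqVneq #|K| n.+1; last by move=> ne; exists 0 => Kn; case/eqP: ne.
  have [B0|B0] := ltP B 0.
    exists 1 => _; split=> // x xB.
    by have := lt_le_trans (le_lt_trans xB B0) (energy_ge0 D x); rewrite ltxx.
  pose f x := \sum_(j in K) (q j x - eps j) ^+ 2.
  have cf : continuous f.
    apply: (@polyfun_continuous _ _ (2 * D)); apply: polyfun_sum => j _.
    by apply: polyfun_exp; apply: polyfun_sub => //; exact: polyfun_cst.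
  have [a _ amin] := box_min (addr_ge0 ler01 B0) cf.
  exists (f a) => _; split=> [|x xB].
    rewrite lt_neqAle eq_sym; apply/andP; split; last first.
      by apply: sumr_ge0 => j _; exact: sqr_ge0.
    rewrite psumr_eq0 => [|j _]; last exact: sqr_ge0.
    apply/allPn; have : ~~ (K \subset [set j | q j a == eps j]).
      apply/negP => /subset_leq_card; rewrite Kn leqNgt ltnS.
      by rewrite eps_generic.
    move=> /subsetPn[j jK]; rewrite inE => qj.
    exists j; first by rewrite mem_index_enum.
    by rewrite jK sqrf_eq0 subr_eq0.
  apply: amin; apply: (@box_of_energy _ _ D); first by rewrite lerDl.
  by apply: le_trans xB _; rewrite lerDr.
have [c cP] := fin_all_exists cK.
have [e e0 eP] := @finite_pos_lower_bound R {set J} (fun K => #|K| == n.+1) c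
  (fun K Kn => (cP K (eqP Kn)).1).
exists e => // K x Kn xB; apply: le_trans (eP K _) _; first by rewrite Kn.
exact: (cP K Kn).2.
Qed.

(** [tau j] asks for [q j > eps j], its negation for [q j < eps j]. The value is non-negative
    exactly when the strict inequality fails, ties included. *)
Definition violation (tau : J -> bool) j x :=
  if tau j then eps j - q j x else q j x - eps j.

Lemma violation_sqr tau j x : violation tau j x ^+ 2 = (q j x - eps j) ^+ 2.
Proof. by rewrite /violation; case: ifP => // _; ring. Qed.

(* [r] depends on [tau] only through the set of violated or tight constraints,
   because the violation of a constraint is determined up to sign by [q] and
   [eps]. *)
Lemma exists_critical_point :
  exists2 r : {set J} -> 'I_n -> E -> R,
    forall K i, polyfun D.*2 (r K i) &
    forall (tau : J -> bool) x0, energy D x0 <= B ->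
      (forall j, violation tau j x0 < 0) ->
      exists2 x, (#|[set j | (0 <= violation tau j x)%R]| <= n)%N &
        forall i, x ord0 i ^+ D.*2.+1 =
          r [set j | (0 <= violation tau j x)%R] i x.
Proof.
have [c c0 cP] := levels_separated.
have [dq dqP] : exists dq : J -> 'I_n -> E -> R, forall j i,
    polyfun D (dq j i) /\ line_deriv i (q j) (dq j i).
  apply: (@fin_all_exists J (fun=> 'I_n -> E -> R) (fun j dqj => forall i,
    polyfun D (dqj i) /\ line_deriv i (q j) (dqj i))) => j.
  apply: (@fin_all_exists _ (fun=> E -> R) (fun i d =>
    polyfun D d /\ line_deriv i (q j) d)) => i.
  by have [d ? ?] := polyfun_line_deriv i (qD j); exists d.
(* With this weight, [n.+1] violated or tight constraints cost at least [t * c = 1 + |B|], which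
   exceeds [B]. *)
pose t := (1 + `|B|) / c.
have t0 : 0 < t by rewrite divr_gt0 // ltr_pwDl.
exists (fun (K : {set J}) i x => - (t / D.+1%:R) * \sum_(j in K) (q j x - eps j) * dq j i x).
  move=> K i; apply: polyfun_scale; apply: polyfun_sum => j _.
  rewrite -addnn; apply: polyfun_mul; last by have [] := dqP j i.
  by apply: polyfun_sub => //; exact: polyfun_cst.
move=> tau x0 x0B x0v.
have vD j : polyfun D (violation tau j).
  by rewrite /violation; case: (tau j); apply: polyfun_sub => //; exact: polyfun_cst.
have [x xmin] := penalized_min vD (ltW t0).
(* All constraints hold strictly at [x0], so the penalty vanishes there. *)
have FB : penalized D (violation tau) t x <= B.
  apply: le_trans (xmin x0) _; rewrite /penalized big1 ?mulr0 ?addr0 // => j _.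
  by rewrite max_l ?ltW // expr0n.
have xB : energy D x <= B by apply: le_trans FB; exact/energy_le_penalized/ltW.
have max_viol j : 0 <= violation tau j x ->
    Num.max 0 (violation tau j x) = violation tau j x by move=> ?; rewrite max_r.
exists x.
  rewrite leqNgt; apply/negP => /exists_subset_card[K /fintype.subsetP KJ Kn].
  have := cP K x Kn xB; apply/negP; rewrite -ltNge.
  have -> : \sum_(j in K) (q j x - eps j) ^+ 2 =
            \sum_(j in K) Num.max 0 (violation tau j x) ^+ 2.
    apply: eq_bigr => j /KJ; rewrite inE => vj.
    by rewrite max_viol // violation_sqr.
  apply: (@le_lt_trans _ _ (\sum_j Num.max 0 (violation tau j x) ^+ 2)).
    rewrite [leRHS](bigID (fun j => j \in K)) /= lerDl.
    by apply: sumr_ge0 => j _; exact: sqr_ge0.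
  rewrite -(ltr_pM2l t0) /t mulfVK ?gt_eqF //.
  apply: (@le_lt_trans _ _ B).
    by apply: le_trans FB; rewrite /penalized lerDr energy_ge0.
  by apply: le_lt_trans (ler_norm B) _; rewrite ltrDr.
move=> i.
pose v' j x := if tau j then - dq j i x else dq j i x.
have v'P j : line_deriv i (violation tau j) (v' j).
  move=> y; have [p pE p'] := (dqP j i).2 y.
  rewrite /violation /v'; case: (tau j).
    exists ((eps j)%:P - p) => [s|]; first by rewrite !hornerE pE.
    by rewrite derivB derivC sub0r hornerN p'.
  exists (p - (eps j)%:P) => [s|]; first by rewrite !hornerE pE.
  by rewrite derivB derivC subr0 p'.
have := penalized_critical (ltW t0) v'P xmin.
have -> : \sum_j Num.max 0 (violation tau j x) * v' j x =
    \sum_(j in [set j | (0 <= violation tau j x)%R]) (q j x - eps j) * dq j i x.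
  rewrite [RHS]big_mkcond /=; apply: eq_bigr => j _; rewrite inE.
  have [vj|vj] := leP 0 (violation tau j x); last by rewrite mul0r.
  by rewrite /v' /violation; case: (tau j) => //; ring.
set S := \sum_(j in _) _ => H.
apply: (@mulfI _ D.+1%:R); first by rewrite pnatr_eq0.
by rewrite H; field; rewrite addrC natr1 pnatr_eq0.
Qed.

End Critical.

(** Expand the product over [j] of [1 + y + y], where [None] contributes 1 and each of the two other
    values [y]. For [y <= 1] this bounds the number of partial patterns with small support. *)
Lemma sum_support_expr (y : R) :
  \sum_(k : {ffun J -> option bool}) y ^+ #|[set j | k j != None]| =
  (1 + 2 * y) ^+ #|J|.
Proof.
have -> : (1 + 2 * y) ^+ #|J| =
    \prod_(j : J) \sum_(o : option bool) (if o is Some _ then y else 1).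
  rewrite prodr_const (bigD1 None) //= (bigD1 (Some true)) //=.
  rewrite (bigD1 (Some false)) //= big1 => [|[[]|] //].
  by congr (_ ^+ _); ring.
rewrite bigA_distr_bigA /=; apply: eq_bigr => k _.
rewrite -prodr_const big_mkcond /=; apply: eq_bigr => j _; rewrite inE.
by case: (k j).
Qed.

Theorem card_sign_patterns (A : {set {ffun J -> bool}}) (y : R) :
  (forall tau, tau \in A -> exists x, forall j, tau j = (0 < q j x)) ->
  0 <= y <= 1 ->
  #|A|%:R * y ^+ n <= (1 + 2 * y) ^+ #|J| * (D.*2.+1 ^ n)%:R.
Proof.
move=> AP /andP[y0 y1].
have [w wP] : exists w : {ffun J -> bool} -> E, forall tau, tau \in A ->
    forall j, tau j = (0 < q j (w tau)).
  apply: (@fin_all_exists _ (fun=> E) (fun tau x => tau \in A ->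
    forall j, tau j = (0 < q j x))) => tau.
  case tA : (tau \in A); last by exists 0.
  by have [x xP] := AP _ tA; exists x.
(* Levels below the least positive value of the [q j] at the witnesses leave their sign patterns
   unchanged and make all inequalities strict. *)
have [e e0 eP] := @finite_pos_lower_bound R _
  (fun u : {ffun J -> bool} * J => 0 < q u.2 (w u.1)) _ (fun=> id).
have [eps eps_e eps_gen] := generic_levels qD e0.
pose B := \sum_(tau : {ffun J -> bool}) energy D (w tau).
have wB tau : energy D (w tau) <= B.
  rewrite /B (bigD1 tau) //= lerDl; apply: sumr_ge0 => k _.
  exact: energy_ge0.
have [r rD rP] := exists_critical_point B eps_gen.
have [z zP] : exists z : {ffun J -> bool} -> E, forall tau, tau \in A ->
    let K := [set j | (0 <= violation eps tau j (z tau))%R] in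
    (#|K| <= n)%N /\
    (forall i, z tau ord0 i ^+ D.*2.+1 = r K i (z tau)).
  apply: (@fin_all_exists _ (fun=> E) (fun (tau : {ffun J -> bool}) x =>
    tau \in A ->
    let K := [set j | (0 <= violation eps tau j x)%R] in
    (#|K| <= n)%N /\ (forall i, x ord0 i ^+ D.*2.+1 = r K i x))) => tau.
  case tA : (tau \in A); last by exists 0.
  have [|x ? ?] := rP tau (w tau) (wB tau); last by exists x.
  move=> j; rewrite /violation (wP _ tA).
  have /andP[eps0 epse] := eps_e j; have := eP (tau, j); rewrite /=.
  by have [_ /(_ isT)|qj _] := ltP 0 (q j (w tau)); lra.
(* [k tau] is the restriction of [tau] to its violated or tight constraints. *)
pose k (tau : {ffun J -> bool}) : {ffun J -> option bool} :=
  [ffun j => if 0 <= violation eps tau j (z tau) then Some (tau j) else None].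
have supp_k (tau : {ffun J -> bool}) : [set j | k tau j != None] =
    [set j | (0 <= violation eps tau j (z tau))%R].
  by apply/setP => j; rewrite !inE ffunE; case: ifP.
pose P := [set h : {ffun J -> option bool} | (#|[set j | h j != None]| <= n)%N].
have cardA : (#|A| <= #|P| * D.*2.+1 ^ n)%N.
  apply: (@card_le_fibers _ _ _ _ k) => [tau tA|h _].
    by rewrite inE supp_k; have [] := zP _ tA.
  set A' : {set {ffun J -> bool}} := [set _ in _ | _].
  have A'P tau : tau \in A' -> tau \in A /\ k tau = h.
    by rewrite inE => /andP[? /eqP].
  rewrite -card_sig.
  apply: (@card_zeros R n {tau | tau \in A'} D.*2
    (r [set j | h j != None]) (fun tau => z (val tau))) => [tau tau' zz|i|tau i].
  (* If [tau] and [tau'] differ at [j], their violations at the common point are opposite, so they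
     cannot both be negative; and where both are recorded, [k] tells the signs apart. *)
  - apply/val_inj/ffunP => j; have [tA kt] := A'P _ (valP tau).
    have [tA' kt'] := A'P _ (valP tau').
    have := congr1 (fun f : {ffun J -> option bool} => f j) (etrans kt (esym kt')).
    rewrite !ffunE -zz /violation.
    case: (val tau j); case: (val tau' j) => //;
      do 2![case: leP => ?] => // _; exfalso; lra.
  - exact: rD.
  - have [tA <-] := A'P _ (valP tau); rewrite supp_k.
    by have [_] := zP _ tA.
(* As [y <= 1], every pattern in [P] has weight at least [y ^+ n] in [sum_support_expr]. *)
apply: (@le_trans _ _ ((#|P| * D.*2.+1 ^ n)%:R * y ^+ n)).
  by rewrite ler_wpM2r ?exprn_ge0 // ler_nat.
rewrite natrM mulrAC ler_wpM2r // -sum_support_expr -sum1_card natr_sum mulr_suml.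
rewrite [leRHS](bigID (mem P)) /=; apply: ler_wpDr.
  by apply: sumr_ge0 => h _; rewrite exprn_ge0.
apply: ler_sum => h; rewrite inE mul1r => hn.
by apply: ler_wiXn2l => //; rewrite y0.
Qed.

End SignPatterns.

(** * Activation patterns of a network *)

Section Values.
Variables (T : Type) (U V : finType).

Definition values (P : T -> Prop) (f : T -> U) : {set U} :=
  [set u | `[< exists2 t, P t & f t = u >]].

Lemma valuesP (P : T -> Prop) (f : T -> U) u :
  reflect (exists2 t, P t & f t = u) (u \in values P f).
Proof. by rewrite inE; exact: asboolP. Qed.

Lemma eq_values (P : T -> Prop) (f g : T -> U) :
  (forall t, P t -> f t = g t) -> values P f = values P g.
Proof.
move=> fg; apply/setP => u; apply/valuesP/valuesP => -[t Pt <-]; exists t => //.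
  by rewrite fg.
exact: fg.
Qed.

End Values.

(** Sorting the pairs by first component gives classes of at most [b] elements. This multiplies the
    counts of successive layers. *)
Lemma card_values_pair (R : realType) (T : Type) (U V : finType) (P : T -> Prop)
    (f : T -> U) (g : T -> V) (a b : R) : 0 <= b ->
  #|values P f|%:R <= a ->
  (forall u, #|values (fun t => P t /\ f t = u) g|%:R <= b) ->
  #|values P (fun t => (f t, g t))|%:R <= a * b.
Proof.
move=> b0 fa gb; apply: le_trans (ler_wpM2r b0 fa).
rewrite -sum1_card natr_sum (partition_big fst (mem (values P f))) /=; last first.
  by move=> w; move=> /valuesP[t Pt <-]; apply/valuesP; exists t.
rewrite mulr_natl -sumr_const; apply: ler_sum => u _; apply: le_trans (gb u).
rewrite -natr_sum ler_nat sum1dep_card.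
set S := [set w | _].
have snd_inj : {in S &, injective (@snd U V)}.
  move=> [u1 w1] [u2 w2] /[!inE]/andP[_ /eqP/= ->] /andP[_ /eqP/= ->] /= ->.
  by [].
rewrite -(card_in_imset snd_inj); apply/subset_leq_card/fintype.subsetP => v.
move=> /imsetP[[u1 w] uwS ->]; move: uwS.
rewrite inE => /andP[/valuesP[t Pt [fu gw]] /eqP/= u1u].
by apply/valuesP; exists t; rewrite // fu u1u.
Qed.

(** Take [y = n / (2 #|J|)] in [card_sign_patterns]: then [(1 + 2 y) ^ #|J|] is at most [e ^ n], and
    [n <= 2 * #|J|] gives [y <= 1]. *)
Lemma card_values_sign (R : realType) n (J : finType) D (q : J -> 'rV[R]_n -> R)
    (P : 'rV[R]_n -> Prop) :
  (0 < n)%N -> (n <= 2 * #|J|)%N -> (forall j, polyfun D (q j)) ->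
  #|values P (fun x => [ffun j => 0 < q j x])|%:R <=
    (2 * expR 1 * (D.*2.+1 * #|J|)%:R / n%:R) ^+ n :> R.
Proof.
move=> n0 nJ qD; set A := values _ _.
have n0' : (0 : R) < n%:R by rewrite ltr0n.
have J0 : (0 : R) < #|J|%:R by rewrite ltr0n; lia.
pose y : R := n%:R / (2 * #|J|%:R).
have y0 : 0 < y by rewrite divr_gt0 // mulr_gt0.
have yn0 : 0 < y ^+ n by rewrite exprn_gt0.
rewrite -(ler_pM2r yn0).
apply: le_trans (card_sign_patterns qD (A := A) (y := y) _ _) _.
- move=> tau /valuesP[x _ <-]; exists x => j.
  by rewrite ffunE.
- by rewrite ltW //= ler_pdivrMr ?mulr_gt0 // mul1r -natrM ler_nat.
rewrite -exprMn.
have -> : 2 * expR 1 * (D.*2.+1 * #|J|)%:R / n%:R * y = expR 1 * D.*2.+1%:R :> R.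
  by rewrite /y natrM; field; rewrite !gt_eqF.
rewrite exprMn natrX ler_wpM2r ?exprn_ge0 // -expRM_natl mulr1.
have -> : n%:R = #|J|%:R * (2 * y) :> R.
  by rewrite /y; field; rewrite gt_eqF.
rewrite expRM_natl lerXn2r ?nnegrE ?expR_ge0 //.
  by rewrite addr_ge0 // mulr_ge0 // ltW.
exact: expR_ge1Dx.
Qed.

Section NetworkPatterns.
Variables (R : realType) (n d p m : nat).
Local Notation E := 'rV[R]_n.
Variables (th : E -> seq R) (x : 'I_m -> 'cV[R]_d).
Hypothesis th1 : forall j, polyfun 1 (fun w => (th w)`_j).

Definition activation l (w : E) : {ffun 'I_m * 'I_p -> bool} :=
  [ffun iu => 0 < hidden p (th w) l (x iu.1) iu.2 ord0].

(** Patterns of the layers strictly below [l], nested so that the last layer splits off as the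
    second component. *)
Fixpoint history_type (l : nat) : finType :=
  if l is l'.+1 then (history_type l' * {ffun 'I_m * 'I_p -> bool})%type
  else unit.

Fixpoint history (l : nat) (w : E) : history_type l :=
  if l is l'.+1 then (history l' w, activation l' w) else tt.

Lemma affine_polyfun o a b D (f : 'I_b -> E -> R) (i : 'I_a) :
  (forall v, polyfun D (f v)) ->
  polyfun D.+1 (fun w => affine (th w) o a (\col_v f v w) i ord0).
Proof.
move=> fD; apply: (@eq_polyfun _ _ _ (fun w =>
  \sum_(v < b) (th w)`_(o + i * b + v)%N * f v w + (th w)`_(o + a * b + i)%N)).
  by move=> w; rewrite !mxE; congr (_ + _); apply: eq_bigr => v _; rewrite !mxE.
apply: polyfun_add; last by apply: polyfun_le (th1 _).
by apply: polyfun_sum => v _; rewrite -add1n; apply: polyfun_mul.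
Qed.

(** Once the history is fixed, each [relu] below layer [l] is the identity or 0, and each layer
    raises the degree by one through its weights. *)
Lemma hidden_polyfun l (h : history_type l) i u :
  exists2 f, polyfun l.+1 f &
    forall w, history l w = h -> hidden p (th w) l (x i) u ord0 = f w.
Proof.
elim: l h u => [h|l IH [h a]] u /=.
  have f0 v : polyfun 0 (fun _ : E => x i v ord0) by exact: polyfun_cst.
  eexists; first exact: (affine_polyfun 0 u f0).
  move=> w _; congr (affine _ _ _ _ _ _); apply/matrixP => v k.
  by rewrite mxE ord1.
have [f fP] : exists f : 'I_p -> E -> R, forall v, polyfun l.+1 (f v) /\
    forall w, history l w = h -> hidden p (th w) l (x i) v ord0 = f v w.
  apply: (@fin_all_exists _ (fun=> E -> R) (fun v f => polyfun l.+1 f /\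
    forall w, history l w = h -> hidden p (th w) l (x i) v ord0 = f w)) => v.
  by have [f ? ?] := IH h v; exists f.
have gD v : polyfun l.+1 (fun w => if a (i, v) then f v w else 0).
  by case: (a (i, v)); [have [] := fP v|exact: polyfun_cst].
eexists; first exact: (affine_polyfun (offset d p l.+1) u gD).
move=> w [hw aw]; congr (affine _ _ _ _ _ _); apply/matrixP => v k.
by rewrite !mxE ord1 -aw ffunE /= -(fP v).2.
Qed.

(** Given the layers below [k], the pattern of layer [k] is a sign pattern of [m * p] polynomials of
    degree at most [k.+1]. *)
Lemma card_history l : (0 < n)%N -> (0 < p)%N -> (n <= 2 * m)%N ->
  #|values (fun=> True) (history l)|%:R <=
    \prod_(k < l) (2 * expR 1 * (k.+1.*2.+1 * (m * p))%:R / n%:R) ^+ n :> R.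
Proof.
move=> n0 p0 nm; elim: l => [|l IH].
  rewrite big_ord0 (_ : 1 = 1%:R) // ler_nat.
  by apply: leq_trans (max_card _) _; rewrite card_unit.
rewrite big_ord_recr /=; apply: (card_values_pair _ IH).
  by rewrite exprn_ge0 // divr_ge0 // mulr_ge0 // mulr_ge0 // expR_ge0.
move=> h; have [f fP] : exists f : 'I_m * 'I_p -> E -> R, forall iu,
    polyfun l.+1 (f iu) /\ forall w, history l w = h ->
      hidden p (th w) l (x iu.1) iu.2 ord0 = f iu w.
  apply: (@fin_all_exists _ (fun=> E -> R) (fun iu f => polyfun l.+1 f /\
    forall w, history l w = h -> hidden p (th w) l (x iu.1) iu.2 ord0 = f w)).
  by move=> [i u]; have [f ? ?] := hidden_polyfun h i u; exists f.
rewrite (@eq_values _ _ _ _ (fun w => [ffun iu => 0 < f iu w])); last first.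
  by move=> w [_ hw]; apply/ffunP => iu; rewrite !ffunE (fP iu).2.
have cJ : #|{: 'I_m * 'I_p}| = (m * p)%N by rewrite card_prod !card_ord.
rewrite -cJ; apply: card_values_sign => //; last by move=> iu; have [] := fP iu.
by rewrite cJ; nia.
Qed.

Lemma card_dichotomies L (y : 'I_m -> R) :
  (0 < n)%N -> (0 < p)%N -> (n <= 2 * m)%N -> (0 < L)%N ->
  #|values (fun=> True) (fun w => [ffun i => y i < network L p (th w) (x i)])|%:R
  <= (\prod_(k < L) (2 * expR 1 * (k.+1.*2.+1 * (m * p))%:R / n%:R) ^+ n) *
     (2 * expR 1 * (L.+1.*2.+1 * m)%:R / n%:R) ^+ n :> R.
Proof.
case: L => // L n0 p0 nm _.
pose out (w : E) := [ffun i => y i < network L.+1 p (th w) (x i)].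
(* The dichotomies are projections of pairs of a history and an output pattern. *)
apply: (@le_trans _ _ (#|values (fun=> True) (fun w => (history L.+1 w, out w))|%:R : R)).
  rewrite ler_nat; set A := values _ (fun w => (_, _)).
  apply: leq_trans (leq_imset_card snd A); apply/subset_leq_card/fintype.subsetP.
  move=> u /valuesP[w _ <-]; apply/imsetP; exists (history L.+1 w, out w) => //.
  by apply/valuesP; exists w.
apply: card_values_pair; last 1 first.
- move=> [h a]; have [f fP] : exists f : 'I_m -> E -> R, forall i,
      polyfun L.+2 (f i) /\ forall w, history L.+1 w = (h, a) ->
        network L.+1 p (th w) (x i) = f i w.
    apply: (@fin_all_exists _ (fun=> E -> R) (fun i f => polyfun L.+2 f /\
      forall w, history L.+1 w = (h, a) -> network L.+1 p (th w) (x i) = f w)).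
    move=> i; have [g gP] : exists g : 'I_p -> E -> R, forall v,
        polyfun L.+1 (g v) /\ forall w, history L w = h ->
          hidden p (th w) L (x i) v ord0 = g v w.
      apply: (@fin_all_exists _ (fun=> E -> R) (fun v g => polyfun L.+1 g /\
        forall w, history L w = h -> hidden p (th w) L (x i) v ord0 = g w)) => v.
      by have [g ? ?] := hidden_polyfun h i v; exists g.
    have gD v : polyfun L.+1 (fun w => if a (i, v) then g v w else 0).
      by case: (a (i, v)); [have [] := gP v|exact: polyfun_cst].
    eexists; split; first exact: (affine_polyfun (offset d p L.+1) (@ord0 0) gD).
    move=> w [hw aw]; rewrite /network /=; congr (affine _ _ _ _ _ _); apply/matrixP => v k.
    by rewrite !mxE ord1 -aw ffunE /= -(gP v).2.
  rewrite (@eq_values _ _ _ _ (fun w => [ffun i => 0 < f i w - y i])).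
    rewrite -[X in (_ * X)%N](card_ord m); apply: card_values_sign => //; rewrite ?card_ord //.
    by move=> i; apply: polyfun_sub; [have [] := fP i|exact: polyfun_cst].
  by move=> w [_ hw]; apply/ffunP => i; rewrite !ffunE (fP i).2 // subr_gt0.
- by rewrite exprn_ge0 // divr_ge0 // mulr_ge0 // mulr_ge0 // expR_ge0.
- exact: card_history.
Qed.

End NetworkPatterns.

(** * Numerical estimates *)

Section Estimates.
Variable R : realType.

(** [exp(-2/3) = exp(-1/24)^16 >= (23/24)^16 >= 1/2]. *)
Lemma ln2_ge : 2 / 3 <= ln 2 :> R.
Proof.
rewrite -[leLHS]expRK ler_ln ?posrE ?expR_gt0 // -[expR _]invrK -expRN.
rewrite invf_ple ?posrE ?expR_gt0 //.
have -> : - (2 / 3) = 16%:R * - (1 / 24) :> R by field.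
rewrite expRM_natl.
apply: (@le_trans _ _ ((1 + - (1 / 24)) ^+ 16)); first by lra.
by rewrite lerXn2r ?nnegrE ?expR_ge0 ?expR_ge1Dx //; lra.
Qed.

(** Three squarings of [e >= 2.56], rounded down to 6.55, 42.9 and 1840. *)
Lemma expR8_ge : 1840 <= expR 1 ^+ 8 :> R.
Proof.
have e8 : (9 / 8) ^+ 8 <= expR 1 :> R.
  rewrite [X in _ <= X](_ : _ = expR (1 / 8) ^+ 8); last first.
    by rewrite -expRM_natl; congr expR; field.
  by apply: lerXn2r; rewrite ?nnegrE ?expR_ge0 //; have := expR_ge1Dx (1 / 8 : R); lra.
have e1 : 256 / 100 <= expR 1 :> R by apply: le_trans e8; lra.
have sq (a b x : R) : 0 <= a -> b <= a ^+ 2 -> a <= x -> b <= x ^+ 2.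
  by move=> a0 ba ax; apply: le_trans ba _; rewrite lerXn2r ?nnegrE // (le_trans a0).
rewrite (exprM _ 4 2) (exprM _ 2 2).
apply: (sq (429 / 10)); [by lra | by lra |].
apply: (sq (655 / 100)); [by lra | by lra |].
by apply: sq e1; lra.
Qed.

Lemma sum_odd_from3 L : (\sum_(k < L) k.+1.*2.+1 = L * (L + 2))%N.
Proof.
elim: L => [|L IH]; first by rewrite big_ord0.
by rewrite big_ord_recr /= IH; lia.
Qed.

(** This solves [2^mu <= 6 e rho mu] for [mu]. A tangent to [ln] reduces the claim to
    [(45 rho)^5 <= (8 e^2 rho^2)^4]. *)
Lemma ln_bound (rho mu : R) : 3 <= rho -> 0 < mu ->
  mu * ln 2 <= ln (6 * (expR 1 * rho) * mu) ->
  mu <= log2 (2 * (2 * (expR 1 * rho)) ^+ 2).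
Proof.
move=> rho3 mu0 H; have e0 : 0 < expR 1 :> R by exact: expR_gt0.
have l2 : 0 < ln 2 :> R by have := ln2_ge; lra.
rewrite /log2 ler_pdivlMr //.
have rho0 : 0 < rho by lra.
(* Linearizing ln at 15/2 absorbs at most a fifth of [mu * ln 2] on the left. *)
have tangent : ln mu <= ln (15 / 2) + (mu / (15 / 2) - 1).
  rewrite -lerBlDl -ln_div ?posrE ?divr_gt0 //.
  set x := mu / _; have x0 : 0 < x by rewrite /x !divr_gt0.
  rewrite [X in ln X](_ : x = 1 + (x - 1)); last by ring.
  by apply: le_ln1Dx; lra.
have H1 : mu * ln 2 <= ln (45 * rho) + mu / (15 / 2).
  apply: (le_trans H); rewrite lnM ?posrE ?mulr_gt0 //.
  have -> : 6 * (expR 1 * rho) = expR 1 * (6 * rho) :> R by ring.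
  rewrite (@lnM _ (expR 1)) ?posrE ?mulr_gt0 //.
  rewrite expRK; have -> : 45 * rho = (6 * rho) * (15 / 2) by field.
  rewrite (@lnM _ (6 * rho)) ?posrE ?mulr_gt0 ?divr_gt0 //; lra.
have H2 : 4 * (mu * ln 2) <= 5 * ln (45 * rho).
  by have := ln2_ge; nra.
apply: (@le_trans _ _ (5 * ln (45 * rho) / 4)); first by rewrite ler_pdivlMr //; lra.
rewrite ler_pdivrMr //.
have -> : 5 * ln (45 * rho) = ln ((45 * rho) ^+ 5).
  by rewrite lnXn ?mulr_gt0 // mulr_natl.
set z := 2 * _ ^+ 2.
have z0 : 0 < z by rewrite /z mulr_gt0 // exprn_gt0 // !mulr_gt0.
have -> : ln z * 4 = ln (z ^+ 4) by rewrite lnXn // mulr_natr.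
rewrite ler_ln ?posrE ?exprn_gt0 ?mulr_gt0 //.
have -> : z ^+ 4 = 4096 * expR 1 ^+ 8 * (rho ^+ 3 * rho ^+ 5) by rewrite /z; ring.
have r3 : 27 <= rho ^+ 3.
  by rewrite (_ : 27 = 3 ^+ 3); [rewrite lerXn2r ?nnegrE //; lra | ring].
have r5 : 0 < rho ^+ 5 by rewrite exprn_gt0.
rewrite exprMn mulrA ler_pM2r //.
(* What remains is [45^5 <= 4096 e^8 rho^3], true since [4096 * 1840 * 27] exceeds [45^5]. *)
have E8 := expR8_ge; set e := _ ^+ 8 in E8 *; set r := _ ^+ 3 in r3 *.
have er : 0 <= (e - 1840) * (r - 27) by rewrite mulr_ge0 ?subr_ge0.
by nra.
Qed.

(** The inequality of means replaces the [L + 1] layer factors by a power of their mean, and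
    logarithms lead to [ln_bound] with [mu = m / ((L + 1) n)]. *)
Lemma shatter_bound (L p n m : nat) :
  (0 < L)%N -> (0 < p)%N -> (0 < n)%N -> (0 < m)%N ->
  2 ^+ m <= (\prod_(k < L) (2 * expR 1 * (k.+1.*2.+1 * (m * p))%:R / n%:R) ^+ n)
     * (2 * expR 1 * (L.+1.*2.+1 * m)%:R / n%:R) ^+ n :> R ->
  m%:R <= (L%:R + 1) * n%:R
    * log2 (2 * (2 * expR 1 * (L%:R + 1) * (p%:R * L%:R / 2 + 1)) ^+ 2 : R).
Proof.
move=> L0 p0 n0 m0 H.
have n0' : (0 : R) < n%:R by rewrite ltr0n.
have m0' : (0 : R) < m%:R by rewrite ltr0n.
have L1 : (0 : R) < L.+1%:R by rewrite ltr0n.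
have e0 : 0 < expR 1 :> R by exact: expR_gt0.
pose a k : R := if (k < L)%N then (k.+1.*2.+1 * p)%:R else L.+1.*2.+1%:R.
pose c : R := 2 * expR 1 * m%:R / n%:R.
pose rho : R := (L%:R + 1) * (p%:R * L%:R / 2 + 1).
have c0 : 0 < c by rewrite divr_gt0 // !mulr_gt0.
have H1 : 2 ^+ m <= (c ^+ L.+1 * \prod_(k < L.+1) a k) ^+ n.
  apply: (le_trans H); rewrite prodrXl -exprMn.
  have cE : c ^+ L.+1 = \prod_(k < L.+1) c by rewrite prodr_const card_ord.
  rewrite cE -big_split /= big_ord_recr /= {2}/a ltnn.
  rewrite le_eqVlt; apply/orP; left; apply/eqP; congr ((_ * _) ^+ _).
    by apply: eq_bigr => k _; rewrite /a ltn_ord /c !natrM; ring.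
  by rewrite /c natrM; ring.
have a0 k : 0 <= a k by rewrite /a; case: ifP; rewrite ler0n.
have suma : \sum_(k < L.+1) a k <= 3 * rho.
  rewrite big_ord_recr /= {2}/a ltnn.
  rewrite (eq_bigr (fun k : 'I_L => k.+1.*2.+1%:R * p%:R)); last first.
    by move=> k _; rewrite /a ltn_ord natrM.
  rewrite -mulr_suml -natr_sum sum_odd_from3 /rho.
  have L1' : 1 <= L%:R :> R by rewrite ler1n.
  have p1 : 1 <= p%:R :> R by rewrite ler1n.
  have -> : L.+1.*2.+1%:R = 2 * L%:R + 3 :> R by rewrite -muln2; ring.
  (* The right side minus the left one is [p L (L - 1) / 2 + L]. *)
  have : 0 <= p%:R * (L%:R * (L%:R - 1)) :> R by rewrite !mulr_ge0 // subr_ge0.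
  by rewrite natrM natrD; lra.
have AGM : \prod_(k < L.+1) a k <= (3 * rho / L.+1%:R) ^+ L.+1.
  have := leif_AGM (A := [pred k : 'I_L.+1 | true]) (E := fun k => a k) (fun k _ => a0 k).
  rewrite card_ord => -[+ _] => /le_trans; apply.
  apply: lerXn2r; rewrite ?nnegrE.
  - by rewrite divr_ge0 // sumr_ge0.
  - by rewrite divr_ge0 //; apply: le_trans suma; rewrite sumr_ge0.
  - by rewrite ler_pM2r ?invr_gt0.
have rho3 : 3 <= rho.
  have L1' : 1 <= L%:R :> R by rewrite ler1n.
  have p1 : 1 <= p%:R :> R by rewrite ler1n.
  rewrite /rho; nra.
have rho0 : 0 < rho by lra.
pose N : R := L.+1%:R * n%:R; have N0 : 0 < N by rewrite mulr_gt0.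
pose mu := m%:R / N; have mu0 : 0 < mu by rewrite divr_gt0.
have y0 : 0 < 6 * (expR 1 * rho) * mu by do 3![rewrite mulr_gt0 //].
have H2 : 2 ^+ m <= (6 * (expR 1 * rho) * mu) ^+ (L.+1 * n).
  apply: (le_trans H1); rewrite exprM; apply: lerXn2r; rewrite ?nnegrE.
  - by rewrite mulr_ge0 ?exprn_ge0 ?(ltW c0) // prodr_ge0.
  - exact/exprn_ge0/ltW.
  have -> : 6 * (expR 1 * rho) * mu = c * (3 * rho / L.+1%:R).
    by rewrite /mu /c /N; field; rewrite !gt_eqF.
  by rewrite [leRHS]exprMn ler_pM2l // exprn_gt0.
have H3 : mu * ln 2 <= ln (6 * (expR 1 * rho) * mu).
  have : ln (2 ^+ m) <= ln ((6 * (expR 1 * rho) * mu) ^+ (L.+1 * n)).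
    by rewrite ler_ln ?posrE ?exprn_gt0.
  rewrite !lnXn // -[_ *+ m]mulr_natl -[_ *+ (_ * _)]mulr_natl natrM -/N => H3.
  by rewrite /mu mulrAC ler_pdivrMr // [leRHS]mulrC.
have := ln_bound rho3 mu0 H3.
rewrite natr1 -/N ler_pdivrMr // mulrC => /le_trans; apply.
rewrite ler_pM2l // le_eqVlt; apply/orP; left; apply/eqP.
by congr (log2 (2 * _ ^+ 2)); rewrite /rho -natr1; ring.
Qed.

(** This serves the case of few points, where the trivial bound [m <= n] is used. *)
Lemma log2_ge1 (L p : nat) :
  1 <= log2 (2 * (2 * expR 1 * (L%:R + 1) * (p%:R * L%:R / 2 + 1)) ^+ 2 : R).
Proof.
have l2 : 0 < ln 2 :> R by have := ln2_ge; lra.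
have e1 : 2 <= expR 1 :> R by have := expR_ge1Dx (1 : R); lra.
rewrite /log2 ler_pdivlMr // mul1r.
set z := _ * (_ + 1); have z1 : 1 <= z.
  apply: mulr_ege1; last by rewrite lerDr divr_ge0 // mulr_ge0.
  by apply: mulr_ege1; [lra | rewrite lerDr].
have z2 : 1 <= z ^+ 2 by rewrite exprn_ege1.
by rewrite ler_ln ?posrE //; lra.
Qed.

End Estimates.

(** * Sparse networks *)

Section Sparsity.
Variables (R : realType) (nb : nat) (s : nb.-tuple bool).

Definition support : {set 'I_nb} := [set i | tnth s i].

Lemma card_support : #|support| = norm0 s.
Proof.
rewrite /norm0 -sum1_count big_tuple -sum1_card.
by apply: eq_bigl => i; rewrite inE.
Qed.

(* One dummy variable makes [inord] available. *)
Local Notation E := 'rV[R]_(norm0 s).+1.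

Definition fill (w : E) : nb.-tuple R :=
  [tuple if i \in support then w ord0 (inord (index i (enum support))) else 0
    | i < nb].

Lemma fill_polyfun j : polyfun 1 (fun w => (fill w)`_j).
Proof.
have [jn|jn] := ltnP j nb; last first.
  apply: (eq_polyfun _ (@polyfun_cst R _ 1 0)) => w.
  by rewrite nth_default // size_tuple.
pose i := Ordinal jn.
case iS : (i \in support).
  apply: (eq_polyfun _ (polyfun_coord R 0 (inord (index i (enum support))))) => w.
  by rewrite (nth_mktuple _ _ i) iS.
by apply: (eq_polyfun _ (@polyfun_cst R _ 1 0)) => w; rewrite (nth_mktuple _ _ i) iS.
Qed.

Lemma fill_surj (theta : nb.-tuple R) :
  (forall k, tnth s k = false -> tnth theta k = 0) ->
  exists w, fill w = theta.
Proof.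
move=> theta0; exists (\row_j (map (tnth theta) (enum support))`_j).
apply: eq_from_tnth => i; rewrite tnth_mktuple; case: ifPn => iS; last first.
  by rewrite theta0 //; move: iS; rewrite inE => /negbTE.
have iE : i \in enum support by rewrite mem_enum.
have ilt : (index i (enum support) < size (enum support))%N by rewrite index_mem.
rewrite mxE inordK; last by rewrite ltnS ltnW // -card_support cardE.
by rewrite (nth_map i) // nth_index.
Qed.

End Sparsity.

(** Shattering [m] points realizes all [2 ^ m] output patterns, whose number [card_dichotomies]
    bounds. *)
Lemma card_shattered_le (R : realType) (d L p m : nat)
    (s : (nb_params d L p).-tuple bool) (S : set (unit_cube R d * R)) :
  (0 < L)%N -> (0 < p)%N ->
  (S #= `I_m)%card -> shatters (@fixed_design_class R d L p s) S ->
  m%:R <= (L%:R + 1) * ((norm0 s)%:R + 1)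
    * log2 (2 * (2 * expR 1 * (L%:R + 1) * (p%:R * L%:R / 2 + 1)) ^+ 2 : R).
Proof.
move=> L0 p0 /card_set_bijP[f [fS f_inj f_surj]] Sh.
have [pts ptsP] : exists pts : 'I_m -> unit_cube R d * R, forall i,
    S (pts i) /\ f (pts i) = i.
  apply: (@fin_all_exists 'I_m (fun=> (unit_cube R d * R)%type)
    (fun (i : 'I_m) x => S x /\ f x = i)) => i.
  by have [x Sx fx] := f_surj i (ltn_ord i); exists x.
set n := (norm0 s).+1.
pose out (w : 'rV[R]_n) : {ffun 'I_m -> bool} :=
  [ffun i => (pts i).2 < network L p (fill w) (val (pts i).1)].
have all_out (b : {ffun 'I_m -> bool}) : b \in values (fun=> True) out.
  pose B : set (unit_cube R d * R) :=
    [set x | S x /\ exists2 i : 'I_m, f x = i & b i]%classic.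
  have [g [theta theta0 ->] BE] := Sh B (fun x => @proj1 _ _).
  have [w wE] := fill_surj theta0.
  apply/valuesP; exists w => //; apply/ffunP => i; rewrite ffunE wE.
  have [Si fi] := ptsP i.
  have BiP : B (pts i) <-> b i.
    split=> [[_ [j]]|bi]; last by split=> //; exists i.
    by rewrite fi => /val_inj ->.
  apply/idP/idP => [lt|/BiP]; last by rewrite BE => -[].
  by apply/BiP; rewrite BE.
have -> : (norm0 s)%:R + 1 = n%:R :> R by rewrite natr1.
(* The counting needs [n <= 2 * m]; otherwise [m <= n] is enough. *)
have [mn|nm] := ltnP (2 * m) n.
  apply: (@le_trans _ _ n%:R); first by rewrite ler_nat; lia.
  have L1 : 1 <= L%:R + 1 :> R by rewrite lerDr.
  have n0 : 0 <= n%:R :> R by [].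
  have log1 := log2_ge1 R L p.
  apply: (@le_trans _ _ ((L%:R + 1) * n%:R)); first exact: ler_peMl.
  by apply: ler_peMr => //; rewrite mulr_ge0.
have m0 : (0 < m)%N by rewrite /n in nm; lia.
apply: shatter_bound => //.
apply: le_trans (card_dichotomies (fun i => val (pts i).1) (@fill_polyfun R _ s)
  (fun i => (pts i).2) _ p0 nm L0) => //.
have -> : 2 ^+ m = #|{ffun 'I_m -> bool}|%:R :> R.
  by rewrite card_ffun card_bool card_ord natrX.
rewrite ler_nat -cardsT; apply/subset_leq_card/fintype.subsetP => b _.
exact: all_out.
Qed.

Unset Implicit Arguments.

Theorem proposition3 (R : realType) (d : nat) (hd : (0 < d)%N)
    (L p : nat) (hL : (0 < L)%N) (hp : (0 < p)%N)
    (s : (nb_params d L p).-tuple bool) :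
  exists2 V : nat,
    VC_subgraph_dim (@fixed_design_class R d L p s) V &
    V%:R <= (L%:R + 1) * ((norm0 s)%:R + 1)
            * log2 (2 * (2 * expR 1 * (L%:R + 1) * (p%:R * L%:R / 2 + 1)) ^+ 2 : R).
Proof.
pose shattered m := `[< exists2 S : set (unit_cube R d * R),
  (S #= `I_m)%card & shatters (@fixed_design_class R d L p s) S >].
set bound := _ * log2 _.
have le_bound m : shattered m -> m%:R <= bound.
  by move=> /asboolP[S Sm Ssh]; exact: card_shattered_le Sm Ssh.
have ex0 : exists m, shattered m.
  exists 0%N; apply/asboolP; exists set0; first by rewrite II0; exact: card_eq00.
  move=> B; rewrite subset0 => ->.
  (* Shattering the empty set only takes a member of the class, here the network with all parameters
     0. *)
  exists (fun x => network L p [tuple of nseq (nb_params d L p) 0] (val x)).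
    exists [tuple of nseq (nb_params d L p) 0] => // k _.
    by rewrite (tnth_nth 0) nth_nseq ltn_ord.
  by rewrite set0I.
(* An integer bound on the sizes of shattered sets yields a largest one. *)
have ub m : shattered m -> (m <= Num.Def.archi_bound bound)%N.
  move=> /le_bound mb; rewrite -(ler_nat R); apply: (le_trans mb (ltW _)).
  by apply: archi_boundP; exact: le_trans (ler0n _ m) mb.
case: (ex_maxnP ex0 ub) => V V_sh V_max; exists V; last exact: le_bound.
split; first exact/asboolP.
by move=> m S Sm Ssh; apply: V_max; apply/asboolP; exists S.
Qed.
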